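(* Let $X,Y$ be real-valued random variables on an atomless probability space $(\Omega,\mathcal F,\mathbb P)$ (no integrability assumed). The following are equivalent: (i) $X\le_{\rm cx} Y$; (ii) for all $p\in(0,1)$, $$\int_0^p F_X^{-1}(t)\,\mathrm dt \ge \int_0^p F_Y^{-1}(t)\,\mathrm dt \quad\text{and}\quad \int_p^1 F_X^{-1}(t)\,\mathrm dt \le \int_p^1 F_Y^{-1}(t)\,\mathrm dt;$$ (iii) for all $w\in\mathbb R$, $$\mathbb E[(X-w)_-]\le \mathbb E[(Y-w)_-]\quad\text{and}\quad \mathbb E[(X-w)_+]\le \mathbb E[(Y-w)_+].$$
   Context: For $x\in\mathbb R$, $x_+=\max\{x,0\}$ and $x_-=\max\{-x,0\}$. An expectation $\mathbb E[Z]$ is called well-defined if $\mathbb E[Z_+]<\infty$ or $\mathbb E[Z_-]<\infty$ (it may then equal $\pm\infty$). $\mathcal U_{\rm cx}$ denotes the set of all convex functions $\mathbb R\to\mathbb R$. We write $X\le_{\rm cx}Y$ if $\mathbb E[u(X)]\le\mathbb E[u(Y)]$ for all $u\in\mathcal U_{\rm cx}$ such that both expectations are well-defined. $F_X^{-1}(t)=\inf\{x\in\mathbb R:\mathbb P(X\le x)\ge t\}$, $t\in(0,1)$, is the left quantile function. The integrals and expectations in (ii) and (iii) are always well-defined, possibly infinite, with values in $[-\infty,\infty]$. *)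

(* Defs.v *)
From HB Require Import structures.
From mathcomp Require Import all_boot all_order all_algebra.
From mathcomp Require Import all_classical all_reals all_analysis.
Set Implicit Arguments. Unset Strict Implicit. Unset Printing Implicit Defensive.
Import Order.TTheory GRing.Theory Num.Def Num.Theory.
Local Open Scope classical_set_scope.
Local Open Scope ring_scope.

Definition pos_part (R : realType) (x : R) : R := Num.max x 0.
Definition neg_part (R : realType) (x : R) : R := Num.max (- x) 0.

Definition convex_fun (R : realType) (u : R -> R) : Prop :=
  forall (x y t : R), 0 <= t -> t <= 1 ->
    u (t * x + (1 - t) * y) <= t * u x + (1 - t) * u y.

Definition atomless d (T : measurableType d) (R : realType)
  (P : probability T R) : Prop :=
  forall A : set T, measurable A -> (0 < P A)%E ->
    exists B : set T, [/\ measurable B, B `<=` A, (0 < P B)%E & (P B < P A)%E].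

(* Expectation E[Z] of a real function Z, as an extended real.
   The integral of mathcomp-analysis is \int Z^+ - \int Z^-. *)
Definition expect d (T : measurableType d) (R : realType)
  (P : probability T R) (Z : T -> R) : \bar R :=
  (\int[P]_(x in setT) (Z x)%:E)%E.

Definition expect_welldef d (T : measurableType d) (R : realType)
  (P : probability T R) (Z : T -> R) : Prop :=
  (\int[P]_(x in setT) (pos_part (Z x))%:E < +oo)%E \/
  (\int[P]_(x in setT) (neg_part (Z x))%:E < +oo)%E.

Definition cx_le d (T : measurableType d) (R : realType)
  (P : probability T R) (X Y : T -> R) : Prop :=
  forall u : R -> R, convex_fun u ->
    expect_welldef P (u \o X) -> expect_welldef P (u \o Y) ->
    (expect P (u \o X) <= expect P (u \o Y))%E.

(* Left quantile F_X^{-1}(t) = inf{x : P(X <= x) >= t}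
   (only used for t in (0,1), where the set is nonempty and bounded below). *)
Definition quantile d (T : measurableType d) (R : realType)
  (P : probability T R) (X : T -> R) (t : R) : R :=
  inf [set x : R | (t%:E <= P (X @^-1` `]-oo, x]))%E].

Definition oitv (R : realType) (a b : R) : set R := `]a, b[%classic.

(* Main.v *)
Require Import Defs.
From HB Require Import structures.
From mathcomp Require Import all_boot all_order all_algebra.
From mathcomp Require Import all_classical all_reals all_analysis.
From mathcomp Require Import measurable_realfun ring lra.
Import Order.TTheory GRing.Theory Num.Def Num.Theory.
Import numFieldNormedType.Exports.
Local Open Scope classical_set_scope.
Local Open Scope ring_scope.

(* All three conditions say that E[(X - w)_+] and E[(X - w)_-] do not exceed the
   same quantities for Y. A nondecreasing convex f >= 0 with a zero is an
   increasing limit of maxima of finitely many hinges a (x - w)_+, and such a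
   maximum is a sum of hinges, so the inequality passes from hinges to f. A
   convex v >= 0 is, up to an arbitrarily small error, a constant plus a
   nondecreasing and a nonincreasing function of this kind; a general convex u
   is the limit of max(u, -n), and no integrability is needed because the
   truncation does not affect the positive part. For the quantile condition,
   X is distributed as its quantile q at a uniform variable, and the integral of
   (q - w)_+ over (0, 1) dominates that of q - w over (p, 1), with equality for
   p = F(w) and for w = q(p); the lower tails are handled by applying the same
   inequality to -q on (0, p). *)

(** * Convex functions and hinges *)
Section convex_functions.
Context {R : realType}.
Implicit Types (x y a w : R) (f u : R -> R) (l : R * R) (s : seq (R * R)).

Definition hinge l x := l.1 * pos_part (x - l.2).

Lemma pos_part_ge0 x : 0 <= pos_part x.
Proof. by rewrite /pos_part le_max lexx orbT. Qed.

Lemma neg_part_ge0 x : 0 <= neg_part x.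
Proof. exact: pos_part_ge0. Qed.

Lemma pos_partD x : pos_part x = x + neg_part x.
Proof. by rewrite /pos_part /neg_part; have [|] := leP x 0; have [|] := leP (- x) 0; lra. Qed.

Lemma pos_part_ge x : x <= pos_part x.
Proof. by rewrite /pos_part le_max lexx. Qed.

Lemma pos_part_le0 x : x <= 0 -> pos_part x = 0.
Proof. by move=> x0; rewrite /pos_part; apply/max_idPr. Qed.

Lemma pos_part_id x : 0 <= x -> pos_part x = x.
Proof. by move=> x0; rewrite /pos_part; apply/max_idPl. Qed.

Lemma hinge_ge0 l x : 0 <= l.1 -> 0 <= hinge l x.
Proof. by move=> l0; rewrite mulr_ge0 ?pos_part_ge0. Qed.

Lemma bigmax_hinge_le s x c : 0 <= c ->
  (forall l, l \in s -> hinge l x <= c) ->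
  \big[Num.max/0]_(l <- s) hinge l x <= c.
Proof.
move=> c0 sc; rewrite big_seq; elim/big_ind: _ => // y z yc zc.
by rewrite ge_max yc zc.
Qed.

Lemma le_bigmax_hinge s x l : l \in s ->
  hinge l x <= \big[Num.max/0]_(l <- s) hinge l x.
Proof. by move=> ls; exact: (le_bigmax_seq 0 l xpredT (hinge^~ x)). Qed.

Lemma ex_min_snd s : s != [::] ->
  exists2 l, l \in s & forall k, k \in s -> l.2 <= k.2.
Proof.
elim: s => // l [|k s] ih _.
  by exists l => [|k]; rewrite inE// => /eqP ->.
have [//|m ms mle] := ih _.
have [lm|/ltW ml] := leP l.2 m.2.
  exists l => [|k']; first by rewrite inE eqxx.
  by rewrite inE => /predU1P[->//|/mle]; exact: le_trans.
exists m => [|k']; first by rewrite inE ms orbT.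
by rewrite inE => /predU1P[->//|/mle].
Qed.

(* Split off the hinge with the leftmost kink: past that kink the maximum is
   the corresponding line plus a maximum of hinges with fewer terms. *)
Lemma bigmax_hinge s : (forall l, l \in s -> 0 <= l.1) ->
  exists2 s' : seq (R * R), forall l, l \in s' -> 0 <= l.1 &
    forall x, \big[Num.max/0]_(l <- s) hinge l x = \sum_(l <- s') hinge l x.
Proof.
have [n] := ubnP (size s); elim: n s => // n ih s sn s0.
have [->|sN0] := eqVneq s [::].
  by exists [::] => // x; rewrite !big_nil.
have [[a w] aws wmin] := ex_min_snd _ sN0.
have a0 : 0 <= a by exact: (s0 _ aws).
(* [g l] encodes the line [l.1 * (x - l.2)] minus [a * (x - w)] by its slope and its zero. It is
   kept only when [a < l.1]: a hinge of slope at most [a] whose kink is not before [w] already lies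
   below [hinge (a, w)]. *)
pose g (l : R * R) := (l.1 - a, (l.1 * l.2 - a * w) / (l.1 - a)).
pose t := map g [seq l <- s | a < l.1].
have gE l x : a < l.1 -> (g l).1 * (x - (g l).2) = l.1 * (x - l.2) - a * (x - w).
  by move=> al; rewrite /g /=; field; lra.
have t0 l : l \in t -> 0 <= l.1.
  by move=> /mapP[k]; rewrite mem_filter => /andP[ak _] -> /=; lra.
(* The leftmost hinge [(a, w)] is not steeper than itself, so the filter removes it and the list
   shrinks. *)
have tn : (size t < n)%N.
  rewrite size_map size_filter; apply: leq_trans (sn : (size s <= n)%N).
  rewrite -(count_predC (fun l : R * R => a < l.1) s) -[ltnLHS]addn0 ltn_add2l.
  by rewrite -has_count; apply/hasP; exists (a, w); rewrite //= ltxx.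
have [t' t'0 t'E] := ih t tn t0.
exists ((a, w) :: t') => [l|x]; first by rewrite inE => /predU1P[->//|/t'0].
rewrite big_cons -t'E.
have tge0 : 0 <= \big[Num.max/0]_(l <- t) hinge l x.
  exact: bigmax_ge_id.
apply/eqP; rewrite eq_le; apply/andP; split.
- apply: bigmax_hinge_le; first by rewrite addr_ge0// hinge_ge0.
  move=> l ls; have wl : w <= l.2 := wmin _ ls.
  have l0 := s0 _ ls.
  have [xl|lx] := leP (x - l.2) 0.
    by rewrite {1}/hinge pos_part_le0// mulr0 addr_ge0// hinge_ge0.
  have -> : hinge l x = l.1 * (x - l.2) by rewrite /hinge pos_part_id// ltW.
  have -> : hinge (a, w) x = a * (x - w) by rewrite /hinge pos_part_id//=; lra.
  have [al|la] := ltP a l.1; last by nra.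
  have gt : g l \in t by apply: map_f; rewrite mem_filter al.
  have := le_bigmax_hinge _ x _ gt; rewrite /hinge.
  have := pos_part_ge (x - (g l).2); have := gE _ x al.
  move: (pos_part _) (\big[_/_]_(_ <- _) _) => p q /= gE' hp hq.
  have : (l.1 - a) * (x - (g l).2) <= (l.1 - a) * p by rewrite ler_wpM2l//; lra.
  by move: gE'; rewrite /g /=; lra.
- have aw_le := le_bigmax_hinge _ x _ aws.
  rewrite -lerBrDl; apply: bigmax_hinge_le; first by rewrite subr_ge0.
  move=> _ /mapP[l /[!mem_filter]/andP[al ls] ->].
  rewrite lerBrDl {1}/hinge /=.
  have [xw|wx] := leP (x - w) 0.
    rewrite (pos_part_le0 _ xw) mulr0 add0r.
    (* To the left of [w] the reduced hinge vanishes: [l] is steeper than [a] and its kink is not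
       before [w], so its line runs below [a * (x - w)] there. *)
    have gx0 : (g l).1 * (x - (g l).2) <= 0.
      have wl : w <= l.2 := wmin _ ls.
      by rewrite gE//; have := s0 _ ls; nra.
    rewrite /hinge pos_part_le0 ?mulr0.
      by apply: le_trans aw_le; exact: hinge_ge0.
    by move: gx0; rewrite pmulr_rle0//= subr_gt0.
  rewrite pos_part_id; last exact: ltW.
  have [gx|gx] := leP (x - (g l).2) 0.
    rewrite {1}/hinge pos_part_le0// mulr0 addr0.
    by apply: le_trans aw_le; rewrite /hinge /= pos_part_id// ltW.
  rewrite {1}/hinge pos_part_id; last exact: ltW.
  rewrite gE// addrC subrK.
  apply: le_trans (le_bigmax_hinge _ x _ ls).
  by rewrite /hinge ler_wpM2l ?pos_part_ge// s0.
Qed.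

(** Strict sublevel sets of a convex function are intervals, and the rays unbounded below generate
    the Borel sets. *)
Lemma convex_measurable f : convex_fun f -> measurable_fun setT f.
Proof.
move=> cf mD; apply: (measurability _ (RGenInftyO.measurableE R)) => //.
move=> /= _ [_ [c ->] <-]; rewrite setTI; apply: is_interval_measurable.
move=> x y /=; rewrite !in_itv/= => fx fy z /andP[xz zy].
have [xy|yx] := ltP x y; last first.
  by have -> : z = x by apply/eqP; rewrite eq_le xz (le_trans zy yx).
have yx0 : 0 < y - x by rewrite subr_gt0.
pose t := (y - z) / (y - x).
have t0 : 0 <= t by rewrite divr_ge0 ?subr_ge0// ltW.
have t1 : t <= 1 by rewrite ler_pdivrMr// mul1r; lra.
have := cf x y t t0 t1; have -> : t * x + (1 - t) * y = z by rewrite /t; field; rewrite gt_eqF.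
have mc : Num.max (f x) (f y) < c by rewrite gt_max fx fy.
have fxm : f x <= Num.max (f x) (f y) by rewrite le_max lexx.
have fym : f y <= Num.max (f x) (f y) by rewrite le_max lexx orbT.
by move=> /le_lt_trans; apply; apply: le_lt_trans mc; nra.
Qed.

(** Convexity multiplied out by [y - x]: free of division, it feeds linear arithmetic directly and
    covers the degenerate case [x = y]. *)
Lemma convex_chord f x y z : convex_fun f -> x <= z -> z <= y ->
  (y - x) * f z <= (y - z) * f x + (z - x) * f y.
Proof.
move=> cf xz zy; have [xy|yx] := ltP x y; last first.
  have -> : x = z by apply/eqP; rewrite eq_le xz (le_trans zy yx).
  have -> : y = z by apply/eqP; rewrite eq_le zy (le_trans yx xz).
  by lra.
have yx0 : 0 < y - x by rewrite subr_gt0.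
pose t := (y - z) / (y - x).
have t0 : 0 <= t by rewrite divr_ge0 ?subr_ge0// ltW.
have t1 : t <= 1 by rewrite ler_pdivrMr// mul1r; lra.
have := cf x y t t0 t1; have -> : t * x + (1 - t) * y = z by rewrite /t; field; rewrite gt_eqF.
have -> : t * f x + (1 - t) * f y = ((y - z) * f x + (z - x) * f y) / (y - x).
  by rewrite /t; field; rewrite gt_eqF.
by rewrite ler_pdivlMr// mulrC.
Qed.

(** The slope is the supremum of the chord slopes to the left of [q]; by [convex_chord], each of
    these is at most every chord slope to the right. *)
Lemma convex_support f q : convex_fun f -> exists a, forall y, f q + a * (y - q) <= f y.
Proof.
move=> cf; pose S := [set (f q - f y) / (q - y) | y in [set y | y < q]].
have Sub y z : y < q -> q < z -> (f q - f y) / (q - y) <= (f z - f q) / (z - q).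
  move=> yq qz; rewrite ler_pdivrMr ?subr_gt0// mulrAC ler_pdivlMr ?subr_gt0//.
  by have := convex_chord _ _ _ _ cf (ltW yq) (ltW qz); lra.
have S0 : S !=set0 by exists ((f q - f (q - 1)) / (q - (q - 1))), (q - 1) => //=; lra.
have ubS : has_ubound S.
  exists ((f (q + 1) - f q) / (q + 1 - q)) => _ [y /= yq <-].
  by apply: Sub => //; lra.
exists (sup S) => y; have [yq|qy|->] := ltgtP y q.
- have : (f q - f y) / (q - y) <= sup S by apply: ub_le_sup => //; exists y.
  by rewrite ler_pdivrMr ?subr_gt0//; lra.
- have : sup S <= (f y - f q) / (y - q).
    by apply: ge_sup => // _ [z /= zq <-]; exact: Sub.
  by rewrite ler_pdivlMr ?subr_gt0//; lra.
- by lra.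
Qed.

(** The positive part of a support line at [q] of positive slope is a hinge that agrees with [f] at
    [q], and it stays below [f] because [f] is nonnegative. *)
Lemma convex_hinge_minorant f c q : convex_fun f -> {homo f : x y / x <= y} ->
  (forall x, 0 <= f x) -> f c = 0 ->
  exists l, [/\ 0 <= l.1, forall x, hinge l x <= f x & f q <= hinge l q].
Proof.
move=> cf ndf f0 fc; have [a sq] := convex_support f q cf.
have a0 : 0 <= a.
  have := sq (q - 1); have : f (q - 1) <= f q by apply: ndf; lra.
  by lra.
have [a_gt0|] := ltP 0 a; last first.
  (* For slope zero, the support line evaluated at [c] gives [f q <= f c = 0], so the zero hinge
     suffices. *)
  move=> ale; exists (0, 0); split => //= [x|]; first by rewrite /hinge mul0r.
  by rewrite /hinge mul0r; have := sq c; rewrite fc (_ : a = 0); lra.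
(* The kink is the zero of the support line at [q]. *)
exists (a, q - f q / a); split => //= [x|].
  rewrite /hinge /= /pos_part maxr_pMr// ge_max mulr0 f0 andbT.
  by apply: le_trans (sq x); rewrite le_eqVlt; apply/orP; left; apply/eqP; field; lra.
rewrite /hinge /= pos_part_id; last by have := divr_ge0 (f0 q) a0; lra.
by rewrite le_eqVlt; apply/orP; left; apply/eqP; field; lra.
Qed.

(** The chord from [z] to [x + 1] lies above [f] at [x], so [f x - f z] is at most
    [(x - z) * (f (x + 1) - f x)]. The 1 added in [M] keeps the divisor positive. *)
Lemma convex_left_approx f x e : convex_fun f -> 0 < e ->
  exists2 y, y < x & forall z, y < z -> z < x -> f x - e <= f z.
Proof.
move=> cf e0; pose M := `|f (x + 1) - f x| + 1.
have M0 : 0 < M by rewrite ltr_wpDl.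
exists (x - e / M) => [|z yz zx]; first by rewrite ltrBlDr ltrDl divr_gt0.
have x1 : x <= x + 1 by lra.
have := convex_chord _ _ _ _ cf (ltW zx) x1.
have : (x - z) * M < e by rewrite -ltr_pdivlMr//; lra.
have : (x - z) * (f (x + 1) - f x) <= (x - z) * M.
  by rewrite ler_wpM2l ?subr_ge0 ?(ltW zx)// /M; have := ler_norm (f (x + 1) - f x); lra.
by lra.
Qed.

Lemma convex_pos_part : convex_fun (@pos_part R).
Proof.
move=> x y t t0 t1; rewrite {1}/pos_part ge_max.
have := pos_part_ge x; have := pos_part_ge y.
have := pos_part_ge0 x; have := pos_part_ge0 y.
by move=> *; apply/andP; split; nra.
Qed.

Lemma convex_max f g : convex_fun f -> convex_fun g -> convex_fun (fun x => Num.max (f x) (g x)).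
Proof.
move=> cf cg x y t t0 t1; rewrite ge_max.
apply/andP; split; [apply: le_trans (cf _ _ _ t0 t1) _|apply: le_trans (cg _ _ _ t0 t1) _];
  by apply: lerD; rewrite ler_wpM2l ?subr_ge0// le_max lexx ?orbT.
Qed.

Lemma convex_cst c : convex_fun (fun _ : R => c).
Proof. by move=> x y t _ _; lra. Qed.

Lemma convex_affine f a b : convex_fun f -> convex_fun (fun x => f (a * x + b)).
Proof.
move=> cf x y t t0 t1; apply: le_trans (cf _ _ _ t0 t1).
by rewrite le_eqVlt; apply/orP; left; apply/eqP; congr f; ring.
Qed.

Lemma convexDr f c : convex_fun f -> convex_fun (fun x => f x + c).
Proof. by move=> cf x y t t0 t1; have := cf x y t t0 t1; lra. Qed.

Lemma convex_hinge l : 0 <= l.1 -> convex_fun (hinge l).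
Proof.
move=> l0 x y t t0 t1; rewrite /hinge.
have := convex_affine _ 1 (- l.2) convex_pos_part x y t t0 t1.
by rewrite !mul1r; nra.
Qed.

Lemma convex_sum_hinge s : (forall l, l \in s -> 0 <= l.1) ->
  convex_fun (fun x => \sum_(l <- s) hinge l x).
Proof.
elim: s => [|l s ih] s0 x y t t0 t1; first by rewrite !big_nil; lra.
rewrite !big_cons.
have hl : 0 <= l.1 by apply: s0; rewrite inE eqxx.
have hs k : k \in s -> 0 <= k.1 by move=> ks; apply: s0; rewrite inE ks orbT.
have := convex_hinge _ hl x y t t0 t1; have := ih hs x y t t0 t1; lra.
Qed.

End convex_functions.

(** * Integrals over subsets of finite measure *)
Section integrals_over_subsets.
Context {d} {T : measurableType d} {R : realType} (mu : {measure set T -> \bar R}).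
Implicit Types (A D : set T) (f q r : T -> R) (b c : R).

Lemma ge0_integralD_cst A f c : measurable A -> measurable_fun A f ->
  (forall x, A x -> 0 <= f x) -> 0 <= c ->
  (\int[mu]_(x in A) (f x + c)%:E = \int[mu]_(x in A) (f x)%:E + c%:E * mu A)%E.
Proof.
move=> mA mf f0 c0; under eq_integral do rewrite EFinD.
rewrite ge0_integralD//.
- by rewrite integral_cst.
- exact/measurable_EFinP.
Qed.

(** Reduces functions bounded below on a set of finite measure to nonnegative integrands, allowing
    the value [+oo]. *)
Lemma integral_lbound_shift A f b : measurable A -> (mu A < +oo)%E ->
  measurable_fun A f -> (forall x, A x -> b <= f x) ->
  (\int[mu]_(x in A) (f x)%:E = \int[mu]_(x in A) (f x - b)%:E + b%:E * mu A)%E.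
Proof.
move=> mA muA mf fb.
have mpos : measurable_fun A (fun x => pos_part (f x)) by exact: measurable_maxr.
have mneg : measurable_fun A (fun x => neg_part (f x)).
  by apply: measurable_maxr => //; exact: measurableT_comp.
have mfb : measurable_fun A (fun x => f x - b) by exact: measurable_funB.
rewrite integralE.
under eq_integral do rewrite funeposE -EFin_max -/(pos_part _).
under [X in (_ - X)%E]eq_integral do rewrite funenegE -EFinN -EFin_max -/(neg_part _).
(* The identity [f - b = f_+ - f_- - b_+ + b_-] is rearranged so that all terms are nonnegative and
   their integrals add. The terms in [f_-] and [b] are finite, so they can be moved back
   afterwards. *)
have balance : (\int[mu]_(x in A) (f x - b)%:E + (pos_part b)%:E * mu A +
    \int[mu]_(x in A) (neg_part (f x))%:E =
    \int[mu]_(x in A) (pos_part (f x))%:E + (neg_part b)%:E * mu A)%E.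
  have fb0 x : A x -> 0 <= f x - b by move=> Ax; rewrite subr_ge0 fb.
  have pf0 x : A x -> 0 <= pos_part (f x) by move=> _; exact: pos_part_ge0.
  rewrite -(ge0_integralD_cst _ _ _ mA mfb fb0 (pos_part_ge0 b)).
  rewrite -(ge0_integralD_cst _ _ _ mA mpos pf0 (neg_part_ge0 b)).
  rewrite -ge0_integralD//.
  - apply: eq_integral => x _; rewrite -EFinD; congr EFin.
    by rewrite !pos_partD; ring.
  - by move=> x Ax; rewrite lee_fin addr_ge0 ?pos_part_ge0// subr_ge0 fb.
  - by apply/measurable_EFinP; exact: measurable_funD.
  - by move=> x Ax; rewrite lee_fin neg_part_ge0.
  - exact/measurable_EFinP.
have muAfin : mu A \is a fin_num by rewrite ge0_fin_numE.
have negfin : (\int[mu]_(x in A) (neg_part (f x))%:E)%E \is a fin_num.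
  rewrite ge0_fin_numE; last by apply: integral_ge0 => x _; rewrite lee_fin neg_part_ge0.
  apply: (@le_lt_trans _ _ (\int[mu]_(x in A) (neg_part b)%:E)%E).
    apply: ge0_le_integral => //.
    - by move=> x _; rewrite lee_fin neg_part_ge0.
    - exact/measurable_EFinP.
    - move=> x Ax; rewrite lee_fin /neg_part ge_max !le_max lexx orbT andbT lerN2.
      by rewrite fb.
  by rewrite integral_cst// lte_mul_pinfty// lee_fin neg_part_ge0.
have bm : b * fine (mu A) = pos_part b * fine (mu A) - neg_part b * fine (mu A).
  by rewrite pos_partD; ring.
move: balance; rewrite -(fineK muAfin) -(fineK negfin) -!EFinM bm.
set pm := pos_part b * _; set nm := neg_part b * _; set v := fine (integral _ _ _).
move: (\int[mu]_(x in A) (f x - b)%:E)%E (\int[mu]_(x in A) (pos_part (f x))%:E)%E => u w.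
case: u => [u| |]; case: w => [w| |] //=; rewrite -?EFinB -?EFinD => -[] // uw.
by congr EFin; lra.
Qed.

(** The upper bound makes the integral of the positive part finite, so the sign comes out even when
    the integral of [f] is [-oo]. *)
Lemma integralN_ubound A f b : measurable A -> (mu A < +oo)%E ->
  measurable_fun A f -> (forall x, A x -> f x <= b) ->
  (\int[mu]_(x in A) (- f x)%:E = - \int[mu]_(x in A) (f x)%:E)%E.
Proof.
move=> mA muA mf fb; under eq_integral do rewrite EFinN.
rewrite integralN//; apply: fin_num_adde_defr.
rewrite ge0_fin_numE; last exact: integral_ge0.
apply: (@le_lt_trans _ _ (\int[mu]_(x in A) (pos_part b)%:E)%E).
  apply: ge0_le_integral => //.
  - by apply: measurable_funepos; exact/measurable_EFinP.
  - move=> x Ax; rewrite funeposE -EFin_max lee_fin /pos_part.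
    by rewrite ge_max !le_max lexx orbT andbT fb.
by rewrite integral_cst// lte_mul_pinfty// ?lee_fin ?pos_part_ge0// ge0_fin_numE.
Qed.

Lemma integral_vanish A D (f : T -> \bar R) : A `<=` D ->
  (forall x, D x -> ~ A x -> f x = 0%E) ->
  (\int[mu]_(x in D) f x = \int[mu]_(x in A) f x)%E.
Proof.
move=> AD f0; rewrite integral_mkcond [RHS]integral_mkcond.
apply: eq_integral => x _; rewrite !patchE.
case: ifPn => [/set_mem Dx|/negP Dx]; case: ifPn => [/set_mem Ax|/negP Ax] //.
  by apply: f0 => // Ax'; apply: Ax; exact: mem_set.
by exfalso; apply: Dx; apply: mem_set; exact: AD.
Qed.

(** Always [q - c <= (q - c)_+], while [r - c = (r - c)_+] since [r] stays above [c]. The common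
    lower bound [b'], chosen not above [c], makes the shifted integrands and the constant [c - b']
    nonnegative. *)
Lemma le_integral_of_pos_part A q r b c : measurable A -> (mu A < +oo)%E ->
  measurable_fun A q -> measurable_fun A r ->
  (forall x, A x -> b <= q x) -> (forall x, A x -> c <= r x) ->
  (\int[mu]_(x in A) (pos_part (q x - c))%:E <=
   \int[mu]_(x in A) (pos_part (r x - c))%:E)%E ->
  (\int[mu]_(x in A) (q x)%:E <= \int[mu]_(x in A) (r x)%:E)%E.
Proof.
move=> mA muA mq mr qb rc qr; pose b' := Num.min b c.
have bc : b' <= c by rewrite /b' ge_min lexx orbT.
have qb' x : A x -> b' <= q x by move=> /qb; apply: le_trans; rewrite /b' ge_min lexx.
have rb' x : A x -> b' <= r x by move=> /rc; exact: le_trans.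
rewrite (integral_lbound_shift _ _ b')// (integral_lbound_shift _ r b')//.
apply: leeD => //.
have mpos f : measurable_fun A f -> measurable_fun A (fun x => pos_part (f x - c)).
  by move=> mf; apply: measurable_maxr => //; exact: measurable_funB.
apply: (@le_trans _ _ (\int[mu]_(x in A) (pos_part (q x - c) + (c - b'))%:E)%E).
  apply: ge0_le_integral => //.
  - by move=> x Ax; rewrite lee_fin subr_ge0 qb'.
  - by apply/measurable_EFinP; exact: measurable_funB.
  - by apply/measurable_EFinP; apply: measurable_funD => //; exact: mpos.
  - by move=> x Ax; rewrite lee_fin; have := pos_part_ge (q x - c); lra.
apply: (@le_trans _ _ (\int[mu]_(x in A) (pos_part (r x - c) + (c - b'))%:E)%E).
  have cb : 0 <= c - b' by rewrite subr_ge0.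
  rewrite (ge0_integralD_cst _ (fun x => pos_part (q x - c)))//; last 2 first.
  - exact: mpos.
  - by move=> x _; exact: pos_part_ge0.
  rewrite (ge0_integralD_cst _ (fun x => pos_part (r x - c)))//; last 2 first.
  - exact: mpos.
  - by move=> x _; exact: pos_part_ge0.
  exact: leeD.
rewrite le_eqVlt; apply/orP; left; apply/eqP; apply: eq_integral => x /set_mem Ax.
by congr EFin; rewrite pos_part_id ?subr_ge0 ?rc//; ring.
Qed.

(** Converse passage: now [q] stays above [c], so [q - c] is its own positive part, and [r - c] is
    bounded by its positive part. *)
Lemma le_integral_pos_part A q r b c : measurable A -> (mu A < +oo)%E ->
  measurable_fun A q -> measurable_fun A r ->
  (forall x, A x -> c <= q x) -> (forall x, A x -> b <= r x) ->
  (\int[mu]_(x in A) (q x)%:E <= \int[mu]_(x in A) (r x)%:E)%E ->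
  (\int[mu]_(x in A) (pos_part (q x - c))%:E <=
   \int[mu]_(x in A) (pos_part (r x - c))%:E)%E.
Proof.
move=> mA muA mq mr qc rb qr; pose b' := Num.min b c.
have bc : b' <= c by rewrite /b' ge_min lexx orbT.
have rb' x : A x -> b' <= r x by move=> /rb; apply: le_trans; rewrite /b' ge_min lexx.
have qb' x : A x -> b' <= q x by move=> /qc; exact: le_trans.
have muAfin : mu A \is a fin_num by rewrite ge0_fin_numE.
have mpos f : measurable_fun A f -> measurable_fun A (fun x => pos_part (f x - c)).
  by move=> mf; apply: measurable_maxr => //; exact: measurable_funB.
move: qr; rewrite (integral_lbound_shift _ _ b')// (integral_lbound_shift _ r b')//.
rewrite leeD2rE ?fin_numM// => qr.
have cb : 0 <= c - b' by rewrite subr_ge0.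
rewrite -(@leeD2rE _ ((c - b')%:E * mu A)%E) ?fin_numM//.
rewrite -(ge0_integralD_cst _ (fun x => pos_part (q x - c)))//; last 2 first.
- exact: mpos.
- by move=> x _; exact: pos_part_ge0.
rewrite -(ge0_integralD_cst _ (fun x => pos_part (r x - c)))//; last 2 first.
- exact: mpos.
- by move=> x _; exact: pos_part_ge0.
apply: (@le_trans _ _ (\int[mu]_(x in A) (q x - b')%:E)%E).
  rewrite le_eqVlt; apply/orP; left; apply/eqP; apply: eq_integral => x /set_mem Ax.
  by congr EFin; rewrite pos_part_id ?subr_ge0 ?qc//; ring.
apply: (le_trans qr); apply: ge0_le_integral => //.
- by move=> x Ax; rewrite lee_fin subr_ge0 rb'.
- by apply/measurable_EFinP; exact: measurable_funB.
- by apply/measurable_EFinP; apply: measurable_funD => //; exact: mpos.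
- by move=> x Ax; rewrite lee_fin; have := pos_part_ge (r x - c); lra.
Qed.

Lemma le_integral_bigcup (F : nat -> set T) D (f : T -> \bar R) (c : \bar R) :
  {homo F : m n / (m <= n)%N >-> m `<=` n} -> (forall n, measurable (F n)) ->
  measurable D -> measurable_fun D f -> (forall x, D x -> (0 <= f x)%E) ->
  D = \bigcup_n F n ->
  (forall n, (\int[mu]_(x in F n) f x <= c)%E) -> (\int[mu]_(x in D) f x <= c)%E.
Proof.
move=> ndF mF mD mf f0 DF Fc.
have FD n : F n `<=` D by rewrite DF; exact: bigcup_sup.
have Fcvg : (\int[mu]_(x in F n) f x)%E @[n --> \oo] --> (\int[mu]_(x in D) f x)%E.
  rewrite DF; apply: ge0_nondecreasing_set_cvg_integral => //.
  - by move=> m n mn; apply/subsetPset; exact: ndF.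
  - by move=> n; exact: measurable_funS mf.
  - by move=> n x Fx; apply: f0; exact: FD Fx.
by apply: (cvge_to_le Fcvg); exact: nearW.
Qed.

End integrals_over_subsets.

(** * From hinges to convex functions *)
Section monotone_approximation.
Context {d} {T : measurableType d} {R : realType}.

Lemma cvg_nondecreasing_approx (u : nat -> R) (l : R) :
  nondecreasing_seq u -> (forall n, u n <= l) ->
  (forall e, 0 < e -> exists n, l - e <= u n) -> u n @[n --> \oo] --> l.
Proof.
move=> ndu ul lu; apply/cvgrPdist_le => e e0.
have [N lN] := lu _ e0; exists N => // n /= Nn.
rewrite ger0_norm ?subr_ge0//.
by have := ndu _ _ Nn; lra.
Qed.

Lemma le_integral_nondecreasing_lim (mu : {measure set T -> \bar R})
    (f_ : nat -> T -> R) (f : T -> R) (c : \bar R) :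
  (forall n, measurable_fun setT (f_ n)) -> (forall n x, 0 <= f_ n x) ->
  (forall x, nondecreasing_seq (f_ ^~ x)) ->
  (forall x, f_ n x @[n --> \oo] --> f x) ->
  (forall n, (\int[mu]_x (f_ n x)%:E <= c)%E) ->
  (\int[mu]_x (f x)%:E <= c)%E.
Proof.
move=> mf f0 ndf fl fc.
have := @cvg_monotone_convergence _ _ _ mu setT measurableT
  (fun n x => (f_ n x)%:E).
under [X in _ -> _ -> _ -> _ --> X]eq_integral => x _.
  rewrite (_ : limn _ = (f x)%:E); last first.
    by apply/cvg_lim => //; apply: cvg_EFin; [exact: nearW|exact: fl].
  over.
move=> /(_ _ _ _)/cvg_lim <-//.
- apply: lime_le; last exact: nearW.
  apply: ereal_nondecreasing_is_cvgn => m n mn; apply: ge0_le_integral => //.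
  + by move=> x _; rewrite lee_fin.
  + exact/measurable_EFinP.
  + exact/measurable_EFinP.
  + by move=> x _; rewrite lee_fin; exact: ndf.
- by move=> n; exact/measurable_EFinP.
- by move=> n x _; rewrite lee_fin.
- by move=> x _ m n mn; rewrite lee_fin; exact: ndf.
Qed.

End monotone_approximation.

Section dominance.
Context {d} {T : measurableType d} {R : realType} (P : probability T R).
Implicit Types (X Y : T -> R) (f g u v : R -> R).

Lemma convex_comp_measurable f X : convex_fun f -> measurable_fun setT X ->
  measurable_fun setT (fun t => f (X t)).
Proof. by move=> /convex_measurable mf mX; exact: measurableT_comp. Qed.

Definition pos_dominated X Y := forall w,
  (\int[P]_t (pos_part (X t - w))%:E <= \int[P]_t (pos_part (Y t - w))%:E)%E.

Lemma le_integral_hinges X Y s : measurable_fun setT X -> measurable_fun setT Y ->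
  pos_dominated X Y -> (forall l, l \in s -> 0 <= l.1) ->
  (\int[P]_t (\sum_(l <- s) hinge l (X t))%:E <=
   \int[P]_t (\sum_(l <- s) hinge l (Y t))%:E)%E.
Proof.
move=> mX mY XY; elim: s => [|l s ih] s0.
  by under eq_integral do rewrite big_nil; under [leRHS]eq_integral do rewrite big_nil.
have l0 : 0 <= l.1 by apply: s0; rewrite inE eqxx.
have ss0 k : k \in s -> 0 <= k.1 by move=> ks; apply: s0; rewrite inE ks orbT.
have sum0 (Z : T -> R) t : 0 <= \sum_(l <- s) hinge l (Z t).
  by rewrite big_seq; apply: sumr_ge0 => k /ss0; exact: hinge_ge0.
have msum (Z : T -> R) : measurable_fun setT Z ->
    measurable_fun setT (fun t => \sum_(l <- s) hinge l (Z t)).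
  move=> mZ; exact: (convex_comp_measurable _ _ (convex_sum_hinge _ ss0) mZ).
have intE (Z : T -> R) : measurable_fun setT Z ->
    (\int[P]_t (\sum_(k <- l :: s) hinge k (Z t))%:E =
     l.1%:E * \int[P]_t (pos_part (Z t - l.2))%:E +
     \int[P]_t (\sum_(k <- s) hinge k (Z t))%:E)%E.
  move=> mZ; have mpos : measurable_fun setT (fun t => pos_part (Z t - l.2)).
    apply: (convex_comp_measurable _ _ convex_pos_part).
    exact: measurable_funB.
  rewrite -ge0_integralZl//; last 2 first.
  - exact/measurable_EFinP.
  - by move=> t _; rewrite lee_fin pos_part_ge0.
  rewrite -ge0_integralD//.
  - by apply: eq_integral => t _; rewrite big_cons EFinD /hinge EFinM.
  - by move=> t _; rewrite mule_ge0 ?lee_fin ?pos_part_ge0.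
  - apply: measurable_funeM; exact/measurable_EFinP.
  - by move=> t _; rewrite lee_fin.
  - by apply/measurable_EFinP; exact: msum.
rewrite !intE//; apply: leeD; last exact: ih.
by apply: lee_wpmul2l; rewrite ?lee_fin.
Qed.

Lemma le_integral_convex_nondecreasing X Y f c :
  measurable_fun setT X -> measurable_fun setT Y -> pos_dominated X Y ->
  convex_fun f -> {homo f : x y / x <= y} -> (forall x, 0 <= f x) -> f c = 0 ->
  (\int[P]_t (f (X t))%:E <= \int[P]_t (f (Y t))%:E)%E.
Proof.
move=> mX mY XY cf ndf f0 fc.
have /choice[l lP] q := convex_hinge_minorant f c q cf ndf f0 fc.
(* Minorant hinges touching [f] at the rationals, enumerated through [unpickle]. An index that codes
   no rational gets the point 0, which is harmless since every such hinge lies below [f]. *)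
pose g i := l (ratr (odflt (0 : rat) (unpickle i))).
pose m_ n x := \big[Num.max/0]_(k <- map g (iota 0 n)) hinge k x.
have g0 n k : k \in map g (iota 0 n) -> 0 <= k.1.
  by move=> /mapP[i _ ->]; have [] := lP (ratr (odflt 0 (unpickle i))).
have m_f n x : m_ n x <= f x.
  apply: bigmax_hinge_le => // _ /mapP[i _ ->].
  by have [_ ->] := lP (ratr (odflt 0 (unpickle i))).
have m_ge0 n x : 0 <= m_ n x by exact: bigmax_ge_id.
have nd_m x : nondecreasing_seq (m_ ^~ x).
  move=> i j ij; apply: bigmax_hinge_le => // k /mapP[h hi ->].
  apply: le_bigmax_hinge; apply: map_f.
  by move: hi; rewrite !mem_iota !add0n => /leq_trans -> .
have cvgm x : m_ n x @[n --> \oo] --> f x.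
  apply: cvg_nondecreasing_approx => // e e0.
  have [y yx yf] := convex_left_approx f x e cf e0.
  have [q] := rat_in_itvoo yx; rewrite in_itv/= => /andP[yq qx].
  (* The hinge chosen at the rational [q] is among the first [pickle q + 1]. Being nondecreasing,
     its value at [x > q] is at least [f q], hence at least [f x - e]. *)
  exists (pickle q).+1; apply: le_trans (yf _ yq qx) _.
  have [lq0 _ /le_trans fq] := lP (ratr q).
  apply: fq; apply: (@le_trans _ _ (hinge (l (ratr q)) x)).
    rewrite /hinge ler_wpM2l// /pos_part ge_max !le_max lexx orbT andbT.
    by apply/orP; left; rewrite lerB// ltW.
  apply: le_bigmax_hinge; apply/mapP; exists (pickle q).
    by rewrite mem_iota add0n ltnSn.
  by rewrite /g pickleK.
have mm n : measurable_fun setT (m_ n).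
  have [s s0 sE] := bigmax_hinge _ (g0 n).
  by apply: convex_measurable; rewrite /m_ (funext sE); exact: convex_sum_hinge.
apply: (le_integral_nondecreasing_lim P (fun n t => m_ n (X t))) => //.
  by move=> n; exact: measurableT_comp.
(* The same sum of hinges represents the maximum for both variables, so the comparison follows from
   that of single hinges; on the side of [Y] the maximum is then bounded by [f]. *)
move=> n; have [s s0 sE] := bigmax_hinge _ (g0 n).
apply: (@le_trans _ _ (\int[P]_t (m_ n (Y t))%:E)%E); last first.
  apply: ge0_le_integral => //.
  - by move=> t _; rewrite lee_fin.
  - by apply/measurable_EFinP; exact: measurableT_comp.
  - by apply/measurable_EFinP; exact: convex_comp_measurable.
  - by move=> t _; rewrite lee_fin.
rewrite /m_; under eq_integral do rewrite sE.
under [leRHS]eq_integral do rewrite sE.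
exact: le_integral_hinges.
Qed.


(** A nonnegative convex function is nondecreasing to the right of a zero, so composing it with the
    convex map [x -> max(x, a)] preserves convexity. *)
Lemma convex_right_part g a : convex_fun g -> (forall x, 0 <= g x) -> g a = 0 ->
  convex_fun (fun x => g (Num.max x a)) /\
  {homo (fun x => g (Num.max x a)) : x y / x <= y}.
Proof.
move=> cg g0 ga.
have nd x y : a <= x -> x <= y -> g x <= g y.
  move=> ax xy; have := convex_chord _ _ _ _ cg ax xy; rewrite ga mulr0 add0r.
  have [ay|ya] := ltP a y; last first.
    by have -> : x = y by apply/eqP; rewrite eq_le xy (le_trans ya ax).
  have gy := g0 y => h.
  have : (y - a) * g x <= (y - a) * g y by nra.
  by rewrite ler_pM2l// subr_gt0.
split => [x y t t0 t1|x y xy]; last first.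
  by apply: nd; [rewrite le_max lexx orbT|rewrite ge_max !le_max lexx xy orbT].
apply: le_trans (cg _ _ _ t0 t1); apply: nd; first by rewrite le_max lexx orbT.
have mx : x <= Num.max x a by rewrite le_max lexx.
have my : y <= Num.max y a by rewrite le_max lexx.
have mxa : a <= Num.max x a by rewrite le_max lexx orbT.
have mya : a <= Num.max y a by rewrite le_max lexx orbT.
by rewrite ge_max; apply/andP; split; nra.
Qed.

Definition neg_dominated X Y := forall w,
  (\int[P]_t (neg_part (X t - w))%:E <= \int[P]_t (neg_part (Y t - w))%:E)%E.

Lemma neg_dominated_opp X Y : neg_dominated X Y ->
  pos_dominated (fun t => - X t) (fun t => - Y t).
Proof.
move=> XY w; have := XY (- w).
have negE (x : R) : neg_part (x - - w) = pos_part (- x - w).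
  by rewrite /neg_part opprB addrC.
by under eq_integral do rewrite negE; under [leRHS]eq_integral do rewrite negE.
Qed.

Lemma le_integral_convex_zero X Y g a :
  measurable_fun setT X -> measurable_fun setT Y ->
  pos_dominated X Y -> neg_dominated X Y ->
  convex_fun g -> (forall x, 0 <= g x) -> g a = 0 ->
  (\int[P]_t (g (X t))%:E <= \int[P]_t (g (Y t))%:E)%E.
Proof.
move=> mX mY pXY nXY cg g0 ga.
(* [g1] is [g] to the right of its zero [a], and [g2 (- x)] is [g] to the left of it. Each vanishes
   on the other side, and the reflection makes the left part nondecreasing. *)
pose g1 x := g (Num.max x a); pose h x := g (- x); pose g2 x := h (Num.max x (- a)).
have gE x : g x = g1 x + g2 (- x).
  rewrite /g1 /g2 /h; have [xa|ax] := leP x a.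
    by rewrite (_ : Num.max (- x) (- a) = - x) ?opprK ?ga ?add0r//; apply/max_idPl; rewrite lerN2.
  by rewrite (_ : Num.max (- x) (- a) = - a) ?opprK ?ga ?addr0//; apply/max_idPr; rewrite lerN2 ltW.
have ch : convex_fun h.
  have := convex_affine _ (-1) 0 cg; rewrite (_ : (fun x => _) = h)//.
  by apply/funext => x; rewrite mulN1r addr0.
have ha : h (- a) = 0 by rewrite /h opprK.
have [cg1 ndg1] := convex_right_part _ _ cg g0 ga.
have [cg2 ndg2] := convex_right_part _ _ ch (fun x => g0 _) ha.
have intE (Z : T -> R) : measurable_fun setT Z ->
    (\int[P]_t (g (Z t))%:E =
     \int[P]_t (g1 (Z t))%:E + \int[P]_t (g2 (- Z t))%:E)%E.
  move=> mZ; rewrite -ge0_integralD//.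
  - by apply: eq_integral => t _; rewrite gE EFinD.
  - by move=> t _; rewrite lee_fin; exact: g0.
  - by apply/measurable_EFinP; exact: (convex_comp_measurable _ _ cg1 mZ).
  - by move=> t _; rewrite lee_fin; exact: g0.
  - apply/measurable_EFinP; apply: (convex_comp_measurable _ _ cg2).
    exact: measurableT_comp.
rewrite (intE X mX) (intE Y mY); apply: leeD.
- apply: (le_integral_convex_nondecreasing _ _ g1 a) => // [x|]; first exact: g0.
  by rewrite /g1 maxxx.
- apply: (le_integral_convex_nondecreasing (fun t => - X t) (fun t => - Y t) g2 (- a)) => //.
  + exact: measurableT_comp.
  + exact: measurableT_comp.
  + exact: neg_dominated_opp.
  + by move=> x; exact: g0.
  + by rewrite /g2 maxxx.
Qed.

Lemma integralD_cst X c : measurable_fun setT X -> (forall t, 0 <= X t) -> 0 <= c ->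
  (\int[P]_t (X t + c)%:E = \int[P]_t (X t)%:E + c%:E)%E.
Proof.
by move=> mX X0 c0; rewrite ge0_integralD_cst//= probability_setT mule1.
Qed.

(* The infimum of v need not be attained, but raising v to the value at a
   near-minimiser a makes a an exact minimiser and costs at most e. *)
Lemma le_integral_convex_ge0 X Y v :
  measurable_fun setT X -> measurable_fun setT Y ->
  pos_dominated X Y -> neg_dominated X Y ->
  convex_fun v -> (forall x, 0 <= v x) ->
  (\int[P]_t (v (X t))%:E <= \int[P]_t (v (Y t))%:E)%E.
Proof.
move=> mX mY pXY nXY cv v0; apply/lee_addgt0Pr => e e0.
have infv : has_inf (range v).
  by split; [exists (v 0), 0|exists 0 => _ [x _ <-]].
have [_ [a _ <-] va] := inf_adherent e0 infv.
have vae x : v a <= v x + e.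
  apply: le_trans (ltW va) _; rewrite lerD2r; apply: ge_inf; last by exists x.
  by case: infv.
pose g x := Num.max (v x) (v a) - v a.
have g0 x : 0 <= g x by rewrite subr_ge0 le_max lexx orbT.
have cg : convex_fun g.
  apply: convexDr; apply: convex_max => //; exact: convex_cst.
have ga : g a = 0 by rewrite /g maxxx subrr.
have mg (Z : T -> R) : measurable_fun setT Z -> measurable_fun setT (fun t => g (Z t)).
  exact: convex_comp_measurable.
have mv (Z : T -> R) : measurable_fun setT Z -> measurable_fun setT (fun t => v (Z t)).
  exact: convex_comp_measurable.
apply: (@le_trans _ _ (\int[P]_t (g (X t) + v a)%:E)%E).
  apply: ge0_le_integral => //.
  - by move=> t _; rewrite lee_fin.
  - by apply/measurable_EFinP; exact: mv.
  - by apply/measurable_EFinP/measurable_funD => //; exact: mg.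
  - by move=> t _; rewrite lee_fin subrK le_max lexx.
apply: (@le_trans _ _ (\int[P]_t (g (Y t) + v a)%:E)%E).
  rewrite (integralD_cst (fun t => g (X t)))//; last exact: mg.
  rewrite (integralD_cst (fun t => g (Y t)))//; last exact: mg.
  by apply: leeD => //; exact: (le_integral_convex_zero _ _ g a).
rewrite -(integralD_cst (fun t => v (Y t)))//; [|exact: mv|exact: ltW].
apply: ge0_le_integral => //.
- by move=> t _; rewrite lee_fin addr_ge0.
- by apply/measurable_EFinP/measurable_funD => //; exact: mg.
- by apply/measurable_EFinP/measurable_funD => //; exact: mv.
- by move=> t _; rewrite lee_fin subrK ge_max vae andbT lerDl ltW.
Qed.

Lemma expectE X :
  expect P X = (\int[P]_t (pos_part (X t))%:E - \int[P]_t (neg_part (X t))%:E)%E.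
Proof.
rewrite /expect integralE; congr (_ - _)%E; apply: eq_integral => t _.
  by rewrite funeposE /pos_part EFin_max.
by rewrite funenegE /neg_part EFin_max.
Qed.

Lemma neg_partE (x : R) : neg_part x = pos_part (- x).
Proof. by []. Qed.

Lemma min_neg_part_cvg X c :
  (forall n : nat, (\int[P]_t (Num.min (neg_part (X t)) n%:R)%:E <= c)%E) ->
  measurable_fun setT X -> (\int[P]_t (neg_part (X t))%:E <= c)%E.
Proof.
move=> Xc mX; pose f_ n t := Num.min (neg_part (X t)) (n%:R : R).
apply: (le_integral_nondecreasing_lim P f_) => //.
- move=> n; apply: measurable_minr => //.
  by apply: measurable_maxr => //; exact: measurableT_comp.
- by move=> n t; rewrite le_min neg_part_ge0 ler0n.
- move=> t m n mn; rewrite le_min !ge_min lexx/=.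
  by rewrite ler_nat mn orbT.
- move=> t; apply: cvg_nondecreasing_approx.
  + move=> m n mn; rewrite le_min !ge_min lexx/=.
    by rewrite ler_nat mn orbT.
  + by move=> n; rewrite ge_min lexx.
  + move=> e e0; exists (Num.bound (neg_part (X t))).
    rewrite le_min; apply/andP; split; first by lra.
    by have := archi_boundP (neg_part_ge0 (X t)); lra.
Qed.

Lemma le_expect_convex X Y u :
  measurable_fun setT X -> measurable_fun setT Y ->
  pos_dominated X Y -> neg_dominated X Y -> convex_fun u ->
  expect_welldef P (u \o Y) ->
  (expect P (u \o X) <= expect P (u \o Y))%E.
Proof.
move=> mX mY pXY nXY cu wY; rewrite !expectE /=.
have mu (Z : T -> R) : measurable_fun setT Z -> measurable_fun setT (fun t => u (Z t)).
  exact: convex_comp_measurable.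
have mpos (Z : T -> R) : measurable_fun setT Z ->
    measurable_fun setT (fun t => pos_part (u (Z t))).
  by move=> mZ; apply: measurable_maxr => //; exact: mu.
have mneg (Z : T -> R) : measurable_fun setT Z ->
    measurable_fun setT (fun t => neg_part (u (Z t))).
  move=> mZ; apply: measurable_maxr => //; apply: measurableT_comp => //; exact: mu.
have mmin n (Z : T -> R) : measurable_fun setT Z ->
    measurable_fun setT (fun t => Num.min (neg_part (u (Z t))) n%:R).
  by move=> mZ; apply: measurable_minr => //; exact: mneg.
have min_ge0 n x : 0 <= Num.min (neg_part x) n%:R :> R.
  by rewrite le_min neg_part_ge0 ler0n.
have cvx_pos : convex_fun (fun x => pos_part (u x)).
  by apply: convex_max => //; exact: convex_cst.
have posXY : (\int[P]_t (pos_part (u (X t)))%:E <= \int[P]_t (pos_part (u (Y t)))%:E)%E.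
  apply: (le_integral_convex_ge0 _ _ (fun x => pos_part (u x))) => //.
  by move=> x; exact: pos_part_ge0.
have minfin n (Z : T -> R) : measurable_fun setT Z ->
    (\int[P]_t (Num.min (neg_part (u (Z t))) n%:R)%:E)%E \is a fin_num.
  move=> mZ; rewrite ge0_fin_numE; last by apply: integral_ge0 => t _; rewrite lee_fin.
  apply: (@le_lt_trans _ _ (\int[P]_(t in setT) n%:R%:E)%E).
    apply: ge0_le_integral => //.
    - by move=> t _; rewrite lee_fin.
    - by apply/measurable_EFinP; exact: mmin.
    - by move=> t _; rewrite lee_fin ge_min lexx orbT.
  by rewrite integral_cst//= probability_setT mule1 ltry.
(* This is the inequality for [max(u, -n) + n >= 0]. Since [max(u, -n) = u_+ - min(u_-, n)], the
   bounded terms are moved across so that nothing infinite is subtracted. *)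
have truncXY n :
    (\int[P]_t (pos_part (u (X t)))%:E +
     \int[P]_t (Num.min (neg_part (u (Y t))) n%:R)%:E <=
     \int[P]_t (pos_part (u (Y t)))%:E +
     \int[P]_t (Num.min (neg_part (u (X t))) n%:R)%:E)%E.
  pose v x := Num.max (u x) (- n%:R) + n%:R.
  have cv : convex_fun v.
    by apply: convexDr; apply: convex_max => //; exact: convex_cst.
  have v0 x : 0 <= v x.
    by rewrite /v -lerBlDr sub0r le_max lexx orbT.
  have vE x : v x + Num.min (neg_part (u x)) n%:R = pos_part (u x) + n%:R.
    have n0 : 0 <= n%:R :> R by [].
    rewrite /v /neg_part /pos_part; case: (leP (u x) 0) => ux.
      rewrite (_ : Num.max (- u x) 0 = - u x); last by apply/max_idPl; lra.
      by case: (leP (u x) (- n%:R)) => h; case: (leP (- u x) n%:R) => h'; lra.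
    rewrite (_ : Num.max (- u x) 0 = 0); last by apply/max_idPr; lra.
    by case: (leP (u x) (- n%:R)) => h; case: (leP 0 (n%:R : R)) => h'; lra.
  have vint (Z : T -> R) : measurable_fun setT Z ->
      (\int[P]_t (v (Z t))%:E + \int[P]_t (Num.min (neg_part (u (Z t))) n%:R)%:E =
       \int[P]_t (pos_part (u (Z t)))%:E + n%:R%:E)%E.
    move=> mZ; rewrite -(integralD_cst (fun t => pos_part (u (Z t))))//; [|exact: mpos|by move=> t; exact: pos_part_ge0].
    rewrite -ge0_integralD//.
    - by apply: eq_integral => t _; rewrite -EFinD vE.
    - by move=> t _; rewrite lee_fin.
    - by apply/measurable_EFinP; exact: (convex_comp_measurable _ _ cv mZ).
    - by move=> t _; rewrite lee_fin.
    - by apply/measurable_EFinP; exact: mmin.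
  have vXY := le_integral_convex_ge0 X Y v mX mY pXY nXY cv v0.
  rewrite -(@leeD2rE _ n%:R%:E)// addeAC -vint// [leRHS]addeAC -vint//.
  by rewrite -[leLHS]addeA -[leRHS]addeA; apply: leeD; rewrite // addeC.
(* If the positive part for [Y] has infinite integral, well-definedness makes the negative part
   finite and the expectation for [Y] is [+oo]. Otherwise the positive parts of both variables have
   finite integrals. *)
have [pY|] := ltP (\int[P]_t (pos_part (u (Y t)))%:E)%E +oo%E; last first.
  rewrite leye_eq => /eqP pY.
  case: wY => /= wY; first by move: wY; rewrite pY ltxx.
  rewrite pY addye ?leey// -ltNye.
  by rewrite ltNye eqe_oppLR/= lt_eqF.
have pX := le_lt_trans posXY pY.
have pYfin : (\int[P]_t (pos_part (u (Y t)))%:E)%E \is a fin_num.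
  by rewrite ge0_fin_numE//; apply: integral_ge0 => t _; rewrite lee_fin pos_part_ge0.
have pXfin : (\int[P]_t (pos_part (u (X t)))%:E)%E \is a fin_num.
  by rewrite ge0_fin_numE//; apply: integral_ge0 => t _; rewrite lee_fin pos_part_ge0.
(* With finite positive parts, the truncation on the [X] side is dropped first; then [n] tends to
   infinity on the [Y] side by monotone convergence. *)
have key : (\int[P]_t (neg_part (u (Y t)))%:E <=
    \int[P]_t (neg_part (u (X t)))%:E + \int[P]_t (pos_part (u (Y t)))%:E
    - \int[P]_t (pos_part (u (X t)))%:E)%E.
  apply: min_neg_part_cvg => [n|]; last exact: mu.
  rewrite leeBrDr// [leLHS]addeC; apply: le_trans (truncXY n) _.
  rewrite [leLHS]addeC; apply: leeD => //; apply: ge0_le_integral => //.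
  - by move=> t _; rewrite lee_fin.
  - by apply/measurable_EFinP; exact: mmin.
  - by apply/measurable_EFinP; exact: mneg.
  - by move=> t _; rewrite lee_fin ge_min lexx.
have n0 (Z : T -> R) : (0 <= \int[P]_t (neg_part (u (Z t)))%:E)%E.
  by apply: integral_ge0 => t _; rewrite lee_fin neg_part_ge0.
move: pXfin pYfin key (n0 X) (n0 Y).
move: (integral _ _ _) (integral _ _ _) (integral _ _ _) (integral _ _ _) => a b c e.
by move: a b c e => [a| |] [b| |] [c| |] [e| |] //=; rewrite ?lee_fin -?EFinD ?leNye ?leey// ?lee_fin; try lra.
Qed.

End dominance.

(** * Quantiles *)
Section quantile_transform.
Context {d} {T : measurableType d} {R : realType} {P : probability T R}.
Variable X : {RV P >-> R}.
Local Notation mu := (@lebesgue_measure R).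
Local Notation U := (uniform_prob (@ltr01 R)).

(** The Galois connection between quantile and distribution function. The limits of the cdf make the
    defining set nonempty and bounded below for [0 < t < 1], and right continuity shows that the
    infimum is attained. *)
Lemma quantile_le t x : 0 < t < 1 ->
  quantile P X t <= x <-> (t%:E <= cdf X x)%E.
Proof.
move=> /andP[t0 t1]; rewrite /quantile; set S := [set _ | _].
have SE y : S y = (t%:E <= cdf X y)%E by [].
have SNe : S !=set0.
  apply: contrapT => /forallNP SN.
  have : (1 <= t%:E :> \bar R)%E.
    apply: (cvge_to_le (cvg_cdfy1 X)); apply: nearW => y.
    by have /negP := SN y; rewrite -ltNge => /ltW.
  by rewrite lee_fin leNgt t1.
have lbS : has_lbound S.
  apply: contrapT => lbN.
  have : (t%:E <= 0 :> \bar R)%E.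
    apply: (cvge_to_ge (cvg_cdfNy0 X)); apply: nearW => y.
    rewrite leNgt; apply/negP => yt; apply: lbN; exists y => z; rewrite SE => tz.
    rewrite leNgt; apply/negP => /ltW zy.
    by have := lt_le_trans yt tz; rewrite ltNge cdf_nondecreasing.
  by rewrite lee_fin leNgt t0.
have Sinf : S (inf S).
  rewrite SE; apply: (cvge_to_ge (@cdf_right_continuous _ _ _ P X (inf S))).
  near=> y; have Sy : inf S < y by near: y; exact: nbhs_right_gt.
  have [z Sz zy] := inf_lt SNe Sy.
  by apply: (le_trans (Sz : (t%:E <= cdf X z)%E)); rewrite cdf_nondecreasing// ltW.
split => [ix|tx]; last exact: ge_inf.
by apply: (le_trans (Sinf : (t%:E <= cdf X (inf S))%E)); exact: cdf_nondecreasing.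
Unshelve. all: by end_near. Qed.

Lemma quantile_nondecreasing s t : 0 < s -> s <= t -> t < 1 ->
  quantile P X s <= quantile P X t.
Proof.
move=> s0 st t1; apply/quantile_le; first by rewrite s0 (le_lt_trans st).
apply: (@le_trans _ _ t%:E); first by rewrite lee_fin.
by apply/quantile_le => //; rewrite t1 (lt_le_trans s0).
Qed.

Lemma cdfE x : exists p, [/\ 0 <= p, p <= 1 & cdf X x = p%:E].
Proof.
exists (fine (cdf X x)); rewrite fineK ?fin_num_measure//; split => //.
  by rewrite fine_ge0// cdf_ge0.
by rewrite -lee_fin fineK ?fin_num_measure// cdf_le1.
Qed.

(** By [quantile_le], the quantile at [t] exceeds [x] exactly when [t] exceeds the cdf at [x]. This
    yields both the measurability of the quantile and its law. *)
Lemma quantile_preimage x p : cdf X x = p%:E -> 0 <= p ->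
  oitv 0 1 `&` quantile P X @^-1` `]x, +oo[ = `]p, 1[%classic.
Proof.
move=> xp p0; apply/seteqP; split => t /=; rewrite /oitv /= !in_itv/= ?andbT.
  move=> [t01]; rewrite ltNge => /negP xq; have := quantile_le t x t01.
  move=> [_ h]; case/andP: t01 => _ ->; rewrite andbT ltNge; apply/negP => tp.
  by apply: xq; apply: h; rewrite xp lee_fin.
move=> /andP[pt t1]; have t01 : 0 < t < 1 by rewrite t1 (le_lt_trans p0).
split => //; rewrite ltNge; apply/negP => /(quantile_le _ _ t01).1.
by rewrite xp lee_fin leNgt pt.
Qed.

Lemma measurable_quantile : measurable_fun (oitv 0 1) (quantile P X).
Proof.
move=> mD; apply: (measurability _ (RGenOInfty.measurableE R)) => //.
move=> /= _ [_ [x ->] <-]; have [p [p0 _ xp]] := cdfE x.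
by rewrite (quantile_preimage _ _ xp p0); exact: measurable_itv.
Qed.

(** Extension by zero off the open unit interval, turning the quantile into a random variable under
    the uniform law. *)
Let Q : measurableTypeR R -> R := quantile P X \_ (oitv 0 1).

Let mQ : measurable_fun setT Q.
Proof.
by apply/(measurable_restrictT _ _).1; [exact: measurable_itv|exact: measurable_quantile].
Qed.

HB.instance Definition _ := @isMeasurableFun.Build _ _ _ _ Q mQ.

Let integral_uniform_oitv (g : R -> \bar R) : measurable_fun setT g ->
  (forall x, 0 <= g x)%E -> (\int[U]_t g t = \int[mu]_(t in oitv 0 1) g t)%E.
Proof.
move=> mg g0; rewrite (integral_uniform ltr01 mg g0) subr0 invr1 mul1e.
by rewrite integral_itv_bndoo//; exact: measurable_funTS.
Qed.

Let distribution_Q A : measurable A ->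
  distribution U (Q : {mfun _ >-> _}) A = mu (Q @^-1` A `&` oitv 0 1).
Proof.
move=> mA; have mQA : measurable (Q @^-1` A) by rewrite -[X in measurable X]setTI; exact: mQ.
rewrite -integral_indic//; last exact: measurable_itv.
rewrite -integral_uniform_oitv.
- by rewrite integral_indic// setIT.
- exact/measurable_EFinP/measurable_indic.
- by move=> x; rewrite lee_fin.
Qed.

Lemma integral_quantile (f : R -> \bar R) :
  measurable_fun setT f -> (forall x, 0 <= f x)%E ->
  (\int[P]_w f (X w) = \int[mu]_(t in oitv 0 1) f (quantile P X t))%E.
Proof.
move=> mf f0.
transitivity (\int[distribution P X]_y f y)%E.
  by rewrite ge0_integral_distribution.
transitivity (\int[distribution U (Q : {mfun _ >-> _})]_y f y)%E; last first.
  rewrite ge0_integral_distribution// integral_uniform_oitv//=.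
    by apply: eq_integral => t t01; rewrite /Q patchE t01.
  exact: measurableT_comp.
apply: eq_measure_integral => A mA _.
(* The two laws agree on upper rays, where both have mass one minus the cdf at [x]; these rays are
   closed under intersection and generate the Borel sets. *)
have disE x : distribution P X `]x, +oo[ = distribution U (Q : {mfun _ >-> _}) `]x, +oo[.
  have [p [p0 p1 xp]] := cdfE x.
  rewrite distribution_Q; last exact: measurable_itv.
  rewrite (_ : _ `&` _ = `]p, 1[%classic).
    rewrite lebesgue_measure_itv/= lte_fin.
    have := cdf_ccdf_1 X x; rewrite xp /ccdf => p_ccdf.
    move: p_ccdf; case: (distribution P X _) => [r| |]//; rewrite -EFinD => -[pr].
    by case: ltP => p1'; rewrite ?EFinN -?EFinB; congr EFin; lra.
  rewrite -(quantile_preimage _ _ xp p0) setIC; apply/seteqP; split => t [t01];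
    by rewrite /= /Q patchE mem_set.
apply: (measure_unique (@RGenOInfty.G R) (fun k => `]- k%:R, +oo[%classic)) => //.
- exact: RGenOInfty.measurableE.
- move=> _ _ [x ->] [y ->]; exists (Num.max x y).
  apply/seteqP; split => z; rewrite /= !in_itv/= !andbT gt_max; first by case=> -> ->.
  by move=> /andP[].
- by move=> k; exists (- k%:R).
- rewrite -subTset => x _; exists (Num.bound `|x|) => //=; rewrite in_itv/= andbT.
  have := archi_boundP (normr_ge0 x); have := ler_norm (- x); rewrite normrN; lra.
- by move=> _ [x ->]; exact: disE.
- by move=> k; rewrite (le_lt_trans (probability_le1 _ _)) ?ltry.
Qed.

End quantile_transform.

(** * Tail integrals of quantiles versus hinge expectations *)

Section quantile_inequalities.
Context {d} {T : measurableType d} {R : realType} {P : probability T R}.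
Variables X Y : {RV P >-> R}.
Local Notation mu := (@lebesgue_measure R).
Local Notation q := (quantile P X).
Local Notation r := (quantile P Y).

Lemma lebesgue_measure_subitv01 (A : set R) : measurable A -> A `<=` oitv 0 1 ->
  (mu A < +oo)%E.
Proof.
move=> mA A01; apply: (@le_lt_trans _ _ (mu (oitv 0 1))).
  by apply: le_measure; rewrite ?inE//; exact: measurable_itv.
by rewrite lebesgue_measure_itv/= lte01 sube0 ltry.
Qed.

Lemma integral_pos_part_quantile (Z : {RV P >-> R}) w :
  (\int[P]_t (pos_part (Z t - w))%:E =
   \int[mu]_(t in oitv 0 1) (pos_part (quantile P Z t - w))%:E)%E.
Proof.
rewrite (integral_quantile Z (fun x => (pos_part (x - w))%:E))//.
- apply/measurable_EFinP; apply: measurable_maxr => //.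
  exact: measurable_funB.
- by move=> x; rewrite lee_fin pos_part_ge0.
Qed.

Lemma integral_neg_part_quantile (Z : {RV P >-> R}) w :
  (\int[P]_t (neg_part (Z t - w))%:E =
   \int[mu]_(t in oitv 0 1) (pos_part (- quantile P Z t - - w))%:E)%E.
Proof.
rewrite (integral_quantile Z (fun x => (neg_part (x - w))%:E))//.
- by apply: eq_integral => t _; rewrite neg_partE; congr (pos_part _)%:E; ring.
- apply/measurable_EFinP; apply: measurable_maxr => //.
  by apply: measurableT_comp => //; exact: measurable_funB.
- by move=> x; rewrite lee_fin neg_part_ge0.
Qed.

Lemma measurable_pos_part_quantile (Z : {RV P >-> R}) w :
  measurable_fun (oitv 0 1) (fun t => (pos_part (quantile P Z t - w))%:E).
Proof.
apply/measurable_EFinP; apply: measurable_maxr => //.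
by apply: measurable_funB => //; exact: measurable_quantile.
Qed.

Lemma measurable_pos_part_quantileN (Z : {RV P >-> R}) w :
  measurable_fun (oitv 0 1) (fun t => (pos_part (- quantile P Z t - w))%:E).
Proof.
apply/measurable_EFinP; apply: measurable_maxr => //.
apply: measurable_funB => //; apply: measurableT_comp => //.
exact: measurable_quantile.
Qed.

Let upper_sub (p : R) : 0 <= p -> oitv p 1 `<=` oitv 0 1.
Proof. by move=> p0; apply: subset_itvr; rewrite bnd_simp. Qed.

Let lower_sub (p : R) : p <= 1 -> oitv 0 p `<=` oitv 0 1.
Proof. by move=> p1; apply: subset_itvl; rewrite bnd_simp. Qed.

(** On []0, p[] the quantile is bounded above by its value at [p], though its integral may be
    [-oo]. *)
Lemma integral_quantileN p (Z : {RV P >-> R}) : 0 < p < 1 ->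
  (\int[mu]_(t in oitv 0 p) (- quantile P Z t)%:E =
   - \int[mu]_(t in oitv 0 p) (quantile P Z t)%:E)%E.
Proof.
move=> /andP[p0 p1]; apply: (integralN_ubound mu _ _ (quantile P Z p)).
- exact: measurable_itv.
- by apply: lebesgue_measure_subitv01; [exact: measurable_itv|exact/lower_sub/ltW].
- apply: measurable_funS (measurable_quantile Z); first exact: measurable_itv.
  exact/lower_sub/ltW.
- move=> t; rewrite /oitv /= in_itv/= => /andP[t0 tp].
  by apply: quantile_nondecreasing => //; exact: ltW.
Qed.

(** The kink is placed at [r p]. Enlarging []p, 1[] to []0, 1[] can only increase the integral for
    [X] and leaves the one for [Y] unchanged, since [r <= r p] up to [p]. *)
Lemma upper_quantile_le p : pos_dominated P X Y -> 0 < p < 1 ->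
  (\int[mu]_(t in oitv p 1) (q t)%:E <= \int[mu]_(t in oitv p 1) (r t)%:E)%E.
Proof.
move=> XY /andP[p0 p1]; have sub := upper_sub _ (ltW p0).
have mA : measurable (oitv p 1) by exact: measurable_itv.
have muA := lebesgue_measure_subitv01 _ mA sub.
have m01 : measurable (oitv 0 1 : set R) by exact: measurable_itv.
apply: (le_integral_of_pos_part mu (oitv p 1) q r (q p) (r p) mA muA).
- exact: measurable_funS (measurable_quantile X).
- exact: measurable_funS (measurable_quantile Y).
- move=> t; rewrite /oitv /= in_itv/= => /andP[pt t1].
  by apply: quantile_nondecreasing => //; exact: ltW.
- move=> t; rewrite /oitv /= in_itv/= => /andP[pt t1].
  by apply: quantile_nondecreasing => //; exact: ltW.
apply: (@le_trans _ _ (\int[mu]_(t in oitv 0 1) (pos_part (q t - r p))%:E)%E).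
  apply: ge0_subset_integral => //; first exact: measurable_pos_part_quantile.
  by move=> t _; rewrite lee_fin pos_part_ge0.
rewrite -integral_pos_part_quantile; apply: (le_trans (XY _)).
rewrite integral_pos_part_quantile (integral_vanish mu (oitv p 1) (oitv 0 1))// => t.
rewrite /oitv /= !in_itv/= => /andP[t0 t1] /negP; rewrite t1 andbT -leNgt => tp.
by rewrite pos_part_le0// subr_le0 quantile_nondecreasing.
Qed.

(** Mirror image of [upper_quantile_le], applied to [- q] and [- r] on []0, p[] with kink at
    [- r p]. *)
Lemma lower_quantile_le p : neg_dominated P X Y -> 0 < p < 1 ->
  (\int[mu]_(t in oitv 0 p) (r t)%:E <= \int[mu]_(t in oitv 0 p) (q t)%:E)%E.
Proof.
move=> XY p01; have /andP[p0 p1] := p01; have sub := lower_sub _ (ltW p1).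
have mA : measurable (oitv 0 p) by exact: measurable_itv.
have muA := lebesgue_measure_subitv01 _ mA sub.
have m01 : measurable (oitv 0 1 : set R) by exact: measurable_itv.
rewrite -leeN2 -(integral_quantileN p X p01) -(integral_quantileN p Y p01).
apply: (le_integral_of_pos_part mu (oitv 0 p) (fun t => - q t) (fun t => - r t) (- q p) (- r p) mA muA).
- apply: measurableT_comp => //; exact: measurable_funS (measurable_quantile X).
- apply: measurableT_comp => //; exact: measurable_funS (measurable_quantile Y).
- move=> t; rewrite /oitv /= in_itv/= lerN2 => /andP[t0 tp].
  by apply: quantile_nondecreasing => //; exact: ltW.
- move=> t; rewrite /oitv /= in_itv/= lerN2 => /andP[t0 tp].
  by apply: quantile_nondecreasing => //; exact: ltW.
apply: (@le_trans _ _ (\int[mu]_(t in oitv 0 1) (pos_part (- q t - - r p))%:E)%E).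
  apply: ge0_subset_integral => //; first exact: measurable_pos_part_quantileN.
  by move=> t _; rewrite lee_fin pos_part_ge0.
rewrite -integral_neg_part_quantile; apply: (le_trans (XY _)).
rewrite integral_neg_part_quantile (integral_vanish mu (oitv 0 p) (oitv 0 1))// => t.
rewrite /oitv /= !in_itv/= => /andP[t0 t1] /negP; rewrite t0 -leNgt => pt.
by rewrite pos_part_le0// -opprD oppr_le0 subr_ge0 quantile_nondecreasing.
Qed.

Lemma pos_dominated_of_quantile :
  (forall p, 0 < p < 1 ->
     (\int[mu]_(t in oitv p 1) (q t)%:E <= \int[mu]_(t in oitv p 1) (r t)%:E)%E) ->
  pos_dominated P X Y.
Proof.
move=> qr w; rewrite !integral_pos_part_quantile.
have m01 : measurable (oitv 0 1 : set R) by exact: measurable_itv.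
have [F [F0 F1 FE]] := cdfE X w.
have qw t : 0 < t < 1 -> (q t <= w) = (t <= F).
  by move=> t01; apply/idP/idP => [/(quantile_le X _ _ t01)|tF];
    rewrite ?FE ?lee_fin//; apply/(quantile_le X _ _ t01); rewrite FE lee_fin.
(* The level [F] may be 0 or 1, where the hypothesis says nothing, so []0, 1[] is exhausted by the
   intervals []e n, 1[]. The shift by 2 gives [e n < 1] already at [n = 0]. *)
pose e n : R := n.+2%:R^-1.
have e0 n : 0 < e n by rewrite invr_gt0.
have e1 n : e n < 1 by rewrite invf_lt1// ltr1n.
apply: (le_integral_bigcup mu (fun n => oitv (e n) 1) (oitv 0 1)).
- move=> m n mn; apply: subset_itvr; rewrite bnd_simp.
  by rewrite lef_pV2 ?posrE// ler_nat.
- by move=> n; exact: measurable_itv.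
- exact: m01.
- exact: measurable_pos_part_quantile.
- by move=> t _; rewrite lee_fin pos_part_ge0.
- apply/seteqP; split => [t|t [n _]]; last exact/upper_sub/ltW.
  rewrite /oitv /= in_itv/= => /andP[t0 t1].
  exists (Num.bound t^-1) => //; rewrite /= in_itv/= t1 andbT.
  rewrite invf_plt ?posrE//.
  have ti0 : 0 < t^-1 by rewrite invr_gt0.
  by apply: (lt_le_trans (archi_boundP (ltW ti0))); rewrite ler_nat -addn2 leq_addr.
move=> n; pose p := Num.max (e n) F.
have [p1|p1] := ltP p 1; last first.
  (* As [e n < 1], the maximum reaches 1 only through [F]; then [q <= w] on the whole unit interval
     and the integrand vanishes. *)
  have F1' : F = 1.
    by apply/eqP; rewrite eq_le F1; move: p1; rewrite /p le_max leNgt e1.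
  rewrite (_ : integral _ _ _ = 0%E).
    by apply: integral_ge0 => t _; rewrite lee_fin pos_part_ge0.
  apply: integral0_eq => t; rewrite /oitv /= in_itv/= => /andP[te t1].
  by rewrite pos_part_le0// subr_le0 qw ?F1' ?ltW// t1 (lt_trans (e0 n)).
have p0 : 0 < p by rewrite lt_max e0.
have sub := upper_sub _ (ltW p0).
have mA : measurable (oitv p 1) by exact: measurable_itv.
have muA := lebesgue_measure_subitv01 _ mA sub.
(* Points between [e n] and [p] are at most [F], so [q <= w] and the integrand vanishes there.
   Beyond [p] one has [q > w], as [le_integral_pos_part] requires. *)
rewrite (integral_vanish mu (oitv p 1) (oitv (e n) 1)).
- apply: (@le_trans _ _ (\int[mu]_(t in oitv p 1) (pos_part (r t - w))%:E)%E); last first.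
    apply: ge0_subset_integral => //; first exact: measurable_pos_part_quantile.
    by move=> t _; rewrite lee_fin pos_part_ge0.
  apply: (le_integral_pos_part mu (oitv p 1) q r (r p) w mA muA).
  + exact: measurable_funS (measurable_quantile X).
  + exact: measurable_funS (measurable_quantile Y).
  + move=> t tA; have := sub _ tA; rewrite /oitv /= in_itv/= => t01; rewrite ltW// ltNge qw// -ltNge.
    by move: tA; rewrite /oitv /= in_itv/= gt_max => /andP[/andP[]].
  + move=> t; rewrite /oitv /= in_itv/= => /andP[pt t1].
    by apply: quantile_nondecreasing => //; exact: ltW.
  + by apply: qr; rewrite p0.
- by apply: subset_itvr; rewrite bnd_simp le_max lexx.
- move=> t; rewrite /oitv /= !in_itv/= => /andP[et t1] /negP.
  rewrite t1 andbT -leNgt le_max leNgt et/= => tF.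
  by rewrite pos_part_le0// subr_le0 qw// t1 (lt_trans (e0 n)).
Qed.

Lemma neg_dominated_of_quantile :
  (forall p, 0 < p < 1 ->
     (\int[mu]_(t in oitv 0 p) (r t)%:E <= \int[mu]_(t in oitv 0 p) (q t)%:E)%E) ->
  neg_dominated P X Y.
Proof.
move=> qr w; rewrite !integral_neg_part_quantile.
have m01 : measurable (oitv 0 1 : set R) by exact: measurable_itv.
have [F [F0 F1 FE]] := cdfE X w.
have qw t : 0 < t < 1 -> (q t <= w) = (t <= F).
  by move=> t01; apply/idP/idP => [/(quantile_le X _ _ t01)|tF];
    rewrite ?FE ?lee_fin//; apply/(quantile_le X _ _ t01); rewrite FE lee_fin.
pose e n : R := 1 - n.+2%:R^-1.
have e0 n : 0 < e n by rewrite subr_gt0 invf_lt1// ltr1n.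
have e1 n : e n < 1 by rewrite /e ltrBlDr ltrDl invr_gt0.
have oc_sub p : p < 1 -> `]0, p]%classic `<=` oitv 0 1.
  by move=> p1; apply: subset_itvl; rewrite bnd_simp.
(* The intervals are closed on the right because at [t = F] one still has [q t <= w], so the
   integrand may be nonzero there. Once the domain is cut down to []0, p]], the endpoint is
   discarded as a null set. *)
apply: (le_integral_bigcup mu (fun n => `]0, e n]%classic) (oitv 0 1)).
- move=> m n mn; apply: subset_itvl; rewrite bnd_simp lerB//.
  by rewrite lef_pV2 ?posrE// ler_nat.
- by move=> n; exact: measurable_itv.
- exact: m01.
- exact: measurable_pos_part_quantileN.
- by move=> t _; rewrite lee_fin pos_part_ge0.
- apply/seteqP; split => [t|t [n _]]; last exact: oc_sub.
  rewrite /oitv /= in_itv/= => /andP[t0 t1].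
  exists (Num.bound (1 - t)^-1) => //; rewrite /= in_itv/= t0/=.
  have u0 : 0 < 1 - t by rewrite subr_gt0.
  rewrite /e lerBrDr -lerBrDl invf_ple ?posrE//.
  have ui0 : 0 < (1 - t)^-1 by rewrite invr_gt0.
  by apply: (le_trans (ltW (archi_boundP (ltW ui0)))); rewrite ler_nat -addn2 leq_addr.
move=> n; pose p := Num.min (e n) F.
have [p0|p0] := ltP 0 p; last first.
  (* As [e n > 0], the minimum is not positive only when [F = 0]; then [q > w] throughout and the
     integrand vanishes. *)
  have F0' : F = 0.
    by apply/eqP; rewrite eq_le F0 andbT; move: p0; rewrite /p ge_min leNgt e0.
  rewrite (_ : integral _ _ _ = 0%E).
    by apply: integral_ge0 => t _; rewrite lee_fin pos_part_ge0.
  apply: integral0_eq => t; rewrite /= in_itv/= => /andP[t0 te].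
  rewrite pos_part_le0// -opprD oppr_le0 subr_ge0 ltW// ltNge qw ?F0' -?ltNge//.
  by rewrite t0 (le_lt_trans te).
have p1 : p < 1 by rewrite gt_min e1.
have sub := lower_sub _ (ltW p1).
have mA : measurable (oitv 0 p) by exact: measurable_itv.
have muA := lebesgue_measure_subitv01 _ mA sub.
rewrite (integral_vanish mu `]0, p]%classic `]0, e n]%classic).
- rewrite -integral_itv_bndo_bndc; last first.
    exact: measurable_funS (measurable_pos_part_quantileN X _).
  apply: (@le_trans _ _ (\int[mu]_(t in oitv 0 p) (pos_part (- r t - - w))%:E)%E); last first.
    apply: ge0_subset_integral => //; first exact: measurable_pos_part_quantileN.
    by move=> t _; rewrite lee_fin pos_part_ge0.
  apply: (le_integral_pos_part mu (oitv 0 p) (fun t => - q t) (fun t => - r t) (- r p) (- w) mA muA).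
  + apply: measurableT_comp => //; exact: measurable_funS (measurable_quantile X).
  + apply: measurableT_comp => //; exact: measurable_funS (measurable_quantile Y).
  + move=> t tA; have := sub _ tA; rewrite /oitv /= in_itv/= lerN2 => t01; rewrite qw//.
    by move: tA; rewrite /oitv /= in_itv/= lt_min => /andP[_ /andP[_ /ltW]].
  + move=> t; rewrite /oitv /= in_itv/= lerN2 => /andP[t0 tp].
    by apply: quantile_nondecreasing => //; exact: ltW.
  + have p01 : 0 < p < 1 by rewrite p0.
    by rewrite (integral_quantileN p X p01) (integral_quantileN p Y p01) leeN2; exact: qr.
- by apply: subset_itvl; rewrite bnd_simp ge_min lexx.
- move=> t; rewrite /= !in_itv/= => /andP[t0 te] /negP.
  rewrite t0/= -ltNge gt_min ltNge te/= => Ft.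
  rewrite pos_part_le0// -opprD oppr_le0 subr_ge0 ltW// ltNge qw -?ltNge//.
  by rewrite t0 (le_lt_trans te).
Qed.

End quantile_inequalities.

(** * Equivalence of the convex order with the quantile and hinge conditions *)

Theorem theorem1 (d : measure_display) (Omega : measurableType d)
  (R : realType) (P : probability Omega R) (X Y : {RV P >-> R}) :
  atomless P ->
  (cx_le P X Y <->
       (forall p : R, 0 < p < 1 ->
          (\int[lebesgue_measure]_(t in (oitv 0 p)) (quantile P X t)%:E >=
           \int[lebesgue_measure]_(t in (oitv 0 p)) (quantile P Y t)%:E)%E /\
          (\int[lebesgue_measure]_(t in (oitv p 1)) (quantile P X t)%:E <=
           \int[lebesgue_measure]_(t in (oitv p 1)) (quantile P Y t)%:E)%E)) /\
      (cx_le P X Y <->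
       (forall w : R,
          (expect P (fun x => neg_part (X x - w)) <=
           expect P (fun x => neg_part (Y x - w)))%E /\
          (expect P (fun x => pos_part (X x - w)) <=
           expect P (fun x => pos_part (Y x - w)))%E)).
Proof.
move=> _.
(* Hinges are themselves convex test functions, and being nonnegative they have well-defined
   expectations for any variable. *)
have cx_hinges : cx_le P X Y -> pos_dominated P X Y /\ neg_dominated P X Y.
  move=> XY; have wd u (Z : Omega -> R) : (forall x, 0 <= u x) -> expect_welldef P (u \o Z).
    move=> u0; right; under eq_integral do rewrite /= neg_partE pos_part_le0 ?oppr_le0//.
    by rewrite integral0 ltry.
  split=> w.
    apply: (XY (fun x => pos_part (x - w))).
    - have := convex_affine _ 1 (- w) (@convex_pos_part R).
      by under [X in convex_fun X -> _]funext do rewrite mul1r.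
    - by apply: wd => x; exact: pos_part_ge0.
    - by apply: wd => x; exact: pos_part_ge0.
  apply: (XY (fun x => neg_part (x - w))).
  - have := convex_affine _ (-1) w (@convex_pos_part R).
    by under [X in convex_fun X -> _]funext do rewrite mulN1r addrC -opprB.
  - by apply: wd => x; exact: neg_part_ge0.
  - by apply: wd => x; exact: neg_part_ge0.
have hinges_cx : pos_dominated P X Y -> neg_dominated P X Y -> cx_le P X Y.
  by move=> pXY nXY u cu _; exact: le_expect_convex.
split; split.
- move=> /cx_hinges[pXY nXY] p p01; split.
    exact: lower_quantile_le.
  exact: upper_quantile_le.
- move=> qr; apply: hinges_cx.
    by apply: pos_dominated_of_quantile => p /qr[].
  by apply: neg_dominated_of_quantile => p /qr[].
- by move=> /cx_hinges[pXY nXY] w; split; [exact: nXY|exact: pXY].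
- by move=> h; apply: hinges_cx => w; have [] := h w.
Qed.
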